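(* There exist a mean-payoff game $\mathcal{G}$, an $\epsilon>0$, and a strategy $\sigma_0$ of Player 0 in $\mathcal{G}$ such that every strategy $\sigma_1\in\mathsf{BR}^{\epsilon}_1(\sigma_0)$ of Player 1 is an infinite memory strategy.
   Context: An arena $(V,E,\langle V_0,V_1\rangle,w_0,w_1)$ consists of a finite set $V$ of vertices, a set $E\subseteq V\times V$ of edges such that every vertex has at least one successor, a partition of $V$ into $V_0$ (Player 0) and $V_1$ (Player 1), and weight functions $w_0,w_1:E\to\mathbb{Z}$. A mean-payoff game $\mathcal{G}$ is played on such an arena. A play is an infinite path $\pi=\pi_0\pi_1\dots$; a history is a nonempty finite prefix of a play. The payoff of Player $i\in\{0,1\}$ is $\underline{\mathsf{MP}}_i(\pi)=\liminf_{k\to\infty}\frac1k w_i(\pi_0\dots\pi_k)$, where $w_i$ of a history is the sum of the $w_i$-weights of its edges. A strategy of Player $i$ maps each history ending in a vertex of $V_i$ to a successor of that last vertex; $\Sigma_i$ is the set of strategies of Player $i$. $\mathsf{Out}_v(\sigma_0,\sigma_1)$ is the unique play from $v$ consistent with $\sigma_0$ and $\sigma_1$. A strategy is finite memory if it can be realized as the output of a state machine with finitely many states, and infinite memory otherwise. For $\epsilon>0$, $\mathsf{BR}^{\epsilon}_{1}(\sigma_0)$ is the set of $\sigma_1\in\Sigma_1$ such that for all $v\in V$ and all $\sigma_1'\in\Sigma_1$: $\underline{\mathsf{MP}}_1(\mathsf{Out}_v(\sigma_0,\sigma_1))>\underline{\mathsf{MP}}_1(\mathsf{Out}_v(\sigma_0,\sigma_1'))-\epsilon$.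 *)

(* Defs.v *)
From mathcomp Require Import all_boot all_order all_algebra.
From mathcomp Require Import all_classical all_reals all_analysis.

Set Implicit Arguments.
Unset Strict Implicit.
Unset Printing Implicit Defensive.

Import Order.TTheory GRing.Theory Num.Theory.

Local Open Scope ring_scope.

Inductive player := Player0 | Player1.

(* A weight function is total on pairs of vertices, but only its values on
   edges are ever used: weights are evaluated on histories only. *)
Record arena := Arena {
  vertex : finType;
  edges : {set vertex * vertex};
  owned : player -> {set vertex};
  weight : player -> vertex * vertex -> int;
  edges_total : forall v, exists u, (v, u) \in edges;
  owned_partition : owned Player1 = ~: owned Player0
}.

Definition is_play (G : arena) (pi : nat -> vertex G) : Prop :=
  forall k, (pi k, pi k.+1) \in edges G.

Definition is_history (G : arena) (h : seq (vertex G)) : Prop :=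
  exists2 pi, is_play pi & exists n, h = mkseq pi n.+1.

Definition history_weight (G : arena) (i : player) (h : seq (vertex G)) : int :=
  \sum_(e <- zip h (behead h)) weight i e.

(* The liminf is taken in the extended reals, where it always exists; since an
   arena has finitely many weights it is in fact finite.  The junk term at
   k = 0 does not affect it. *)
Definition mean_payoff (R : realType) (G : arena) (i : player)
    (pi : nat -> vertex G) : \bar R :=
  limn_einf (fun k : nat =>
    (k%:R^-1 * (history_weight i (mkseq pi k.+1))%:~R : R)%:E).

(* A strategy is given by a total function on sequences of vertices.  Its
   values outside the histories that end in a vertex of the player are
   irrelevant: no definition below depends on them. *)
Record strategy (G : arena) (i : player) := Strategy {
  strategy_fun :> seq (vertex G) -> vertex G;
  strategy_edge : forall h v, is_history (rcons h v) -> v \in owned G i ->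
    (v, strategy_fun (rcons h v)) \in edges G
}.

Definition consistent (G : arena) (i : player) (sigma : strategy G i)
    (pi : nat -> vertex G) : Prop :=
  forall k, pi k \in owned G i -> pi k.+1 = sigma (mkseq pi k.+1).

Section Outcome.
Context (G : arena) (sigma0 : strategy G Player0) (sigma1 : strategy G Player1).

(* The pair (h, u) stands for the history rcons h u after k moves. *)
Fixpoint outcome_history (v : vertex G) (k : nat) : seq (vertex G) * vertex G :=
  if k is k'.+1 then
    let: (h, u) := outcome_history v k' in
    (rcons h u, if u \in owned G Player0 then sigma0 (rcons h u)
                else sigma1 (rcons h u))
  else ([::], v).

Definition outcome (v : vertex G) (k : nat) : vertex G :=
  (outcome_history v k).2.

Lemma outcome_historyE v k :
  outcome_history v k = (mkseq (outcome v) k, outcome v k).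
Proof.
elim: k => [//|k IHk]; rewrite mkseqS [LHS]surjective_pairing; congr pair.
by rewrite /= IHk.
Qed.

Lemma outcomeS v k : outcome v k.+1 =
  if outcome v k \in owned G Player0 then sigma0 (mkseq (outcome v) k.+1)
  else sigma1 (mkseq (outcome v) k.+1).
Proof. by rewrite /outcome /= outcome_historyE mkseqS. Qed.

Lemma owned1E v : (v \in owned G Player1) = (v \notin owned G Player0).
Proof. by rewrite owned_partition inE. Qed.

Lemma path_play v (s : seq (vertex G)) :
  path (fun a b => (a, b) \in edges G) v s -> is_history (v :: s).
Proof.
pose f (u : vertex G) := xchoose (edges_total u).
move=> vs; pose pi k := if (k <= size s)%N then nth v (v :: s) k
  else iter (k - size s) f (last v s).
have piE k : (size s <= k)%N -> pi k = iter (k - size s) f (last v s).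
  rewrite leq_eqVlt /pi => /predU1P[<-|sk]; last by rewrite leqNgt sk.
  by rewrite leqnn subnn -[size s]/((size (v :: s)).-1) nth_last.
exists pi.
  move=> k; case: (ltnP k (size s)) => ks; last first.
    rewrite !piE ?(leqW ks)// subSn // iterS.
    exact: (xchooseP (edges_total _)).
  by rewrite /pi ks (ltnW ks); exact: (pathP v vs).
exists (size s); apply: (@eq_from_nth _ v); rewrite ?size_mkseq //= => k ks.
by rewrite nth_mkseq // /pi -ltnS ks.
Qed.

Lemma outcome_play v : is_play (outcome v).
Proof.
suff H k : path (fun a b => (a, b) \in edges G) v (mkseq (outcome v \o succn) k).
  move=> k; have /(pathP v)/(_ k) := H k.+1.
  rewrite size_mkseq ltnSn nth_mkseq // => /(_ isT).
  by case: k => [|k] //=; rewrite (nth_mkseq v (outcome v \o succn)).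
elim: k => [//|k IHk]; rewrite mkseqS rcons_path IHk /=.
have E : mkseq (outcome v) k.+1 = v :: mkseq (outcome v \o succn) k.
  by rewrite /mkseq /= (iotaDl 1 0) -map_comp.
have <- : outcome v k = last v (mkseq (outcome v \o succn) k).
  by have := congr1 (last v) E; rewrite mkseqS last_rcons.
have hk : is_history (rcons (mkseq (outcome v) k) (outcome v k)).
  by rewrite -mkseqS E; exact: path_play.
rewrite outcomeS mkseqS; case: ifPn => o; apply: strategy_edge => //.
by rewrite owned1E.
Qed.

Lemma outcome_consistent v :
  consistent sigma0 (outcome v) /\ consistent sigma1 (outcome v).
Proof.
split=> k; rewrite ?owned1E outcomeS; first by move=> ->.
by move/negbTE->.
Qed.

Lemma outcome_unique v pi : pi 0%N = v ->
  consistent sigma0 pi -> consistent sigma1 pi -> pi =1 outcome v.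
Proof.
move=> pi0 c0 c1 k; elim/ltn_ind: k => -[//|k] IHk; rewrite outcomeS.
have <- : mkseq pi k.+1 = mkseq (outcome v) k.+1.
  by apply/eq_in_map => j; rewrite mem_iota => /IHk.
rewrite -IHk //; case: ifPn => o; [exact: c0 | by apply: c1; rewrite owned1E].
Qed.

End Outcome.

(* Mealy machines reading vertices: the state reached on all vertices of the
   history but the last, together with the last one, determines the output. *)
Record machine (V : finType) := Machine {
  state : finType;
  initial : state;
  update : state -> V -> state;
  output : state -> V -> V
}.

Definition realizes (G : arena) (i : player) (m : machine (vertex G))
    (sigma : strategy G i) : Prop :=
  forall h v, is_history (rcons h v) -> v \in owned G i ->
    sigma (rcons h v) = output (foldl (@update _ m) (initial m) h) v.

Definition finite_memory (G : arena) (i : player) (sigma : strategy G i) : Prop :=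
  exists m : machine (vertex G), realizes m sigma.

Definition infinite_memory (G : arena) (i : player) (sigma : strategy G i) : Prop :=
  ~ finite_memory sigma.

Definition BR1 (R : realType) (eps : R) (G : arena)
    (sigma0 : strategy G Player0) : set (strategy G Player1) :=
  [set sigma1 | forall (v : vertex G) (sigma1' : strategy G Player1),
    (mean_payoff R Player1 (outcome sigma0 sigma1' v) - eps%:E
      < mean_payoff R Player1 (outcome sigma0 sigma1 v))%E]%classic.

(* Main.v *)
Require Import Defs.
From mathcomp Require Import all_boot all_order all_algebra.
From mathcomp Require Import all_classical all_reals all_analysis.
From mathcomp Require Import zify.

(** Player 1 owns one vertex, Player 0 owns two, and every change of vertex has
    weight 1.  As long as the history is a prefix of a fixed alternating play
    that is not eventually periodic, Player 0 returns to the vertex of Player 1;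
    after a deviation he never leaves his own vertices.  So the payoff of
    Player 1 is 1 on the fixed play and 0 on every other outcome, and a response
    that is optimal up to 1/2 must produce the fixed play.  But along that play
    a finite-memory strategy makes the pair (memory state, current vertex)
    evolve by a self-map of a finite set, so the play would be eventually
    periodic. *)

Import Order.TTheory GRing.Theory Num.Theory.
Import numFieldNormedType.Exports.

Set Implicit Arguments.
Unset Strict Implicit.
Unset Printing Implicit Defensive.

Local Open Scope ring_scope.

Lemma history_weightE (G : arena) (i : player) (pi : nat -> vertex G) (k : nat) :
  history_weight i (mkseq pi k.+1) = \sum_(j < k) weight i (pi j, pi j.+1).
Proof.
rewrite /history_weight; suff -> : zip (mkseq pi k.+1) (behead (mkseq pi k.+1)) =
    mkseq (fun j => (pi j, pi j.+1)) k.
  by rewrite big_map -{1}[k]subn0 -/(index_iota 0 k) big_mkord.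
apply: (@eq_from_nth _ (pi 0%N, pi 0%N)) => [|j].
  by rewrite size_zip size_behead !size_mkseq; lia.
rewrite size_zip size_behead !size_mkseq => jk.
have {}jk : (j < k)%N by lia.
rewrite nth_zip_cond size_zip size_behead !size_mkseq nth_behead.
rewrite !nth_mkseq ?ifT //; lia.
Qed.

(** After division by [k] the deviation is at most [C / k], which vanishes in the limit. *)
Lemma mean_payoff_bounded_deviation (R : realType) (G : arena) (i : player)
    (pi : nat -> vertex G) (c C : R) :
  (forall k, `|(history_weight i (mkseq pi k.+1))%:~R - c * k%:R| <= C) ->
  mean_payoff R i pi = c%:E.
Proof.
move=> devC; apply: (cvg_limn_einf_sup _).1.
apply: cvg_EFin; first exact: nearW.
apply/subr_cvg0/cvgr0Pnorm_le => e e0.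
near=> k; have k0 : 0 < k%:R :> R by rewrite ltr0n; near: k; exact: nbhs_infty_gt.
rewrite /=; have -> :
    k%:R^-1 * (history_weight i (mkseq pi k.+1))%:~R - c =
    k%:R^-1 * ((history_weight i (mkseq pi k.+1))%:~R - c * k%:R).
  by rewrite mulrBr mulrCA mulVf ?mulr1 // gt_eqF.
rewrite normrM gtr0_norm ?invr_gt0 // ler_pdivrMl //.
apply: le_trans (devC k) _; rewrite -ler_pdivrMr //.
by near: k; exact: nbhs_infty_ger.
Unshelve. all: by end_near.
Qed.

(** By pigeonhole two of the first [#|T| + 1] terms agree, and [f] propagates the agreement
    forever. *)
Lemma iter_eventually_periodic (T : finType) (f : T -> T) (x : nat -> T) :
  (forall n, x n.+1 = f (x n)) ->
  exists i p, (0 < p)%N /\ forall k, (i <= k)%N -> x (k + p)%N = x k.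
Proof.
move=> xS.
have /injectivePn[a [b ab xab]] : ~~ injectiveb (fun j : 'I_#|T|.+1 => x j).
  by apply/negP => /injectiveP/leq_card; rewrite card_ord ltnn.
wlog lt_ab : a b ab xab / (a < b)%N.
  move=> H; have /orP[] : ((a < b) || (b < a))%N by rewrite -neq_ltn.
    exact: H.
  by apply: H; rewrite // eq_sym.
exists (val a), (b - a)%N; split=> [|k /subnK <-]; first by rewrite subn_gt0.
elim: (k - a)%N => [|n IHn]; first by rewrite add0n subnKC // ltnW.
by rewrite !addSn !xS IHn.
Qed.

(** [None] is the vertex of Player 1. His choices mark the odd squares, whose growing gaps rule out
    a period. *)
Definition chase_target (n : nat) : option bool :=
  if odd n then Some `[< exists j, n = (j ^ 2)%N >] else None.

Lemma chase_target_aperiodic (i p : nat) : (0 < p)%N ->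
  ~ forall k, (i <= k)%N -> chase_target (k + p) = chase_target k.
Proof.
(* The base [n = 2(i + p) + 1] is odd, its square is at least [i], and [n > p]; hence [n ^ 2 + p]
   lies strictly between consecutive squares. *)
move=> p0 /(_ ((i + p).*2.+1 ^ 2)%N); rewrite /chase_target oddX /= odd_double.
have -> : `[< exists j, ((i + p).*2.+1 ^ 2)%N = (j ^ 2)%N >] = true.
  by apply/asboolP; exists (i + p).*2.+1.
have le_i : (i <= (i + p).*2.+1 ^ 2)%N.
  by apply: leq_trans (leq_pexp2l (ltn0Sn _) (ltn0Sn 1)); lia.
move=> /(_ le_i); case: ifP => // _ [] /asboolP[j].
have: (p < (i + p).*2.+1)%N by lia.
move: (i + p).*2.+1 => n pn; rewrite -!mulnn => E.
have nj : (n < j)%N by rewrite ltnNge; apply/negP; nia.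
nia.
Qed.

Lemma chase_edges_total (v : option bool) :
  exists u, (v, u) \in [set: option bool * option bool].
Proof. by exists v; rewrite inE. Qed.

Definition chase_owned (i : player) : {set option bool} :=
  if i is Player0 then [set~ None] else [set None].

Lemma chase_owned_partition : chase_owned Player1 = ~: chase_owned Player0.
Proof. by rewrite /= finset.setCK. Qed.

Definition chase : arena :=
  @Arena (option bool) [set: option bool * option bool] chase_owned
    (fun _ e => (e.1 != e.2)%:R) chase_edges_total chase_owned_partition.

Lemma chase_strategy_edge (f : seq (vertex chase) -> vertex chase) (i : player)
    (h : seq (vertex chase)) (v : vertex chase) :
  is_history (rcons h v) -> v \in owned chase i ->
  (v, f (rcons h v)) \in edges chase.
Proof. by rewrite inE. Qed.

Definition chase_strategy (i : player) (f : seq (vertex chase) -> vertex chase) :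
  strategy chase i := Strategy (@chase_strategy_edge f i).

(** A matching history that ends at a vertex of Player 0 has an odd last index, so the target
    continues with [None]. After a deviation Player 0 uses the loop at his current vertex. *)
Definition chase_punisher : strategy chase Player0 :=
  chase_strategy Player0
    (fun h => if h == mkseq chase_target (size h) then None else last None h).

Definition chase_follower : strategy chase Player1 :=
  chase_strategy Player1 (fun h => chase_target (size h)).

Lemma chase_punisherE (pi : nat -> option bool) (k : nat) :
  chase_punisher (mkseq pi k.+1) =
    if mkseq pi k.+1 == mkseq chase_target k.+1 then None else pi k.
Proof.
move Eh: (mkseq pi k.+1) => h /=.
by rewrite -Eh size_mkseq [in last _ _]mkseqS last_rcons.
Qed.

Lemma chase_followerE (pi : nat -> option bool) (k : nat) :
  chase_follower (mkseq pi k.+1) = chase_target k.+1.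
Proof. by move Eh: (mkseq pi k.+1) => h /=; rewrite -Eh size_mkseq. Qed.

Lemma outcome_chase_follower :
  outcome chase_punisher chase_follower None = chase_target.
Proof.
apply/funext => k; apply/esym; move: k; apply: outcome_unique => // k.
  by rewrite chase_punisherE eqxx !inE /chase_target /=; case: (odd k).
by rewrite chase_followerE.
Qed.

Lemma chase_weightE (i : player) (pi : nat -> vertex chase) (k : nat) :
  history_weight i (mkseq pi k.+1) = (\sum_(j < k) (pi j != pi j.+1))%:R.
Proof. by rewrite history_weightE natr_sum. Qed.

Lemma mean_payoff_chase_target (R : realType) :
  mean_payoff R Player1 (chase_target : nat -> vertex chase) = 1%:E.
Proof.
apply: (@mean_payoff_bounded_deviation _ _ _ _ _ 0) => k.
rewrite chase_weightE (eq_bigr (fun=> 1%N)) => [|j _].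
  by rewrite sum1_card card_ord mul1r mulrz_nat subrr normr0.
by rewrite /chase_target /=; case: (odd j).
Qed.

(** From index [n] on, Player 0 only loops, so the vertex changes at most once more: when Player 1
    leaves [None]. *)
Lemma mean_payoff_chase_deviation (R : realType) (pi : nat -> vertex chase)
    (n : nat) :
  consistent chase_punisher pi -> pi n <> chase_target n ->
  mean_payoff R Player1 pi = 0%:E.
Proof.
move=> cpi pin; apply: (@mean_payoff_bounded_deviation _ _ _ _ _ n.+1%:R) => k.
rewrite chase_weightE mul0r subr0 mulrz_nat normr_nat ler_nat.
have small j : (\sum_(l < j) (pi l != pi l.+1) <= j)%N.
  rewrite -[leqRHS]card_ord -sum1_card; apply: leq_sum => l _; exact: leq_b1.
have [kn|nk] := leqP k n; first exact: leq_trans (small k) (leqW kn).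
(* The extra summand counts the one change still available while the play sits at [None]; it makes
   the bound inductive. *)
suff: (\sum_(l < k) (pi l != pi l.+1) + (pi k == None) <= n.+1)%N by lia.
move: nk => /ltnW/subnK <-; elim: (k - n)%N => [|d IHd].
  by rewrite add0n; have := small n; have := leq_b1 (pi n == None); lia.
rewrite addSn big_ord_recr /=; move: IHd; set m := (d + n)%N => IHd.
case E : (pi m) => [b|]; last by move: IHd; rewrite E; case: (pi m.+1) => /=; lia.
have -> : pi m.+1 = Some b.
  rewrite cpi ?E ?inE // chase_punisherE E; case: eqP => [/eq_in_map H|//].
  by case: pin; apply: H; rewrite mem_iota; lia.
by move: IHd; rewrite E eqxx /= !addn0.
Qed.

Lemma finite_memory_not_chase_target (sigma1 : strategy chase Player1) :
  finite_memory sigma1 -> ~ consistent sigma1 chase_target.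
Proof.
case=> m real cons.
pose x k :=
  (foldl (@update _ m) (initial m) (mkseq chase_target k), chase_target k).
(* At the vertices of Player 0 no machine is required: the target always moves from there to
   [None]. *)
pose f (q : state m * vertex chase) : state m * vertex chase :=
  (update q.1 q.2, if q.2 is None then output q.1 q.2 else None).
have xS k : x k.+1 = f (x k).
  rewrite /x /f mkseqS foldl_rcons; congr pair => /=.
  case E : (chase_target k) => [b|].
    by move: E; rewrite /chase_target /=; case: odd.
  rewrite cons ?E ?inE // mkseqS E real ?inE //.
  rewrite -E -mkseqS; exists chase_target; last by exists k.
  by move=> j; rewrite inE.
have [i [p [p0 per]]] := iter_eventually_periodic xS.
by apply: (chase_target_aperiodic p0) => k /per/(congr1 snd).
Qed.

Theorem theorem36 (R : realType) :
  exists (G : arena) (eps : R) (sigma0 : strategy G Player0),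
    0 < eps /\
    forall sigma1 : strategy G Player1,
      BR1 eps sigma0 sigma1 -> infinite_memory sigma1.
Proof.
exists chase, (2^-1), chase_punisher; split=> [|sigma1 br fin].
  by rewrite invr_gt0.
have [cons0 cons1] := outcome_consistent chase_punisher sigma1 None.
apply: (finite_memory_not_chase_target fin).
suff <- : outcome chase_punisher sigma1 None = chase_target by [].
apply/funext => n; apply: contrapT => dev.
(* The competitor [chase_follower] earns 1 and the deviating outcome 0, so [br] would give
   [1 - 2^-1 < 0]. *)
have := br None chase_follower.
rewrite outcome_chase_follower mean_payoff_chase_target.
rewrite (mean_payoff_chase_deviation R cons0 dev) -EFinB lte_fin.
by rewrite subr_lt0 ltNge invf_le1 ?ler1n // ltr0n.
Qed.
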